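(* Let $L$ be a row-Latin array of order $n$. If $L$ has at least $\frac14(5-\sqrt5)n^2$ distinct symbols, then $L$ has a transversal. Consequently $\ell_r(n)\le\big\lceil\frac14(5-\sqrt5)n^2\big\rceil$ for every integer $n>1$.
   Context: An array of order $n$ is an $n\times n$ array with a symbol in each cell; an entry is a triple $(i,j,A_{ij})$. An array is row-Latin if no symbol appears more than once in any row. A transversal of an $n\times n$ array is a set of $n$ entries, no two agreeing in row, column, or symbol. $\ell_r(n)$ is the least positive integer such that $\ell_r(n)\ge n$ and every $n\times n$ row-Latin array with at least $\ell_r(n)$ distinct symbols contains a transversal. *)

(* Defs.v *)
From HB Require Import structures.
From mathcomp Require Import all_boot all_order all_algebra all_field.
From Stdlib Require Import Classical ClassicalEpsilon Wf_nat.
Set Implicit Arguments. Unset Strict Implicit. Unset Printing Implicit Defensive.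
Import Order.TTheory GRing.Theory Num.Theory.

(* An array of order n: cell (i,j) holds symbol A i j; symbols are naturals
   (any finite symbol set embeds into nat). *)
Definition array (n : nat) := 'I_n -> 'I_n -> nat.

Definition row_latin n (A : array n) : Prop :=
  forall (i j1 j2 : 'I_n), A i j1 = A i j2 -> j1 = j2.

Definition nsym n (A : array n) : nat :=
  size (undup [seq A i j | i <- enum 'I_n, j <- enum 'I_n]).

Definition is_transversal n (A : array n) (T : {set 'I_n * 'I_n}) : Prop :=
  #|T| = n /\
  {in T &, forall e f, e != f ->
     [/\ e.1 != f.1, e.2 != f.2 & A e.1 e.2 != A f.1 f.2]}.

Definition has_transversal n (A : array n) : Prop :=
  exists T, is_transversal A T.

Definition lr_good (n k : nat) : Prop :=
  forall A : array n, row_latin A -> k <= nsym A -> has_transversal A.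

Definition is_lr (n l : nat) : Prop :=
  [/\ 0 < l, n <= l, lr_good n l &
      forall k, 0 < k -> n <= k -> lr_good n k -> l <= k].

Lemma nsym_le n (A : array n) : nsym A <= n * n.
Proof.
rewrite /nsym; apply: leq_trans (size_undup _) _.
by rewrite size_allpairs size_enum_ord.
Qed.

Lemma lr_exists n : exists l, is_lr n l.
Proof.
pose P k := 0 < k /\ n <= k /\ lr_good n k.
have ex : exists k, P k.
  exists (n * n).+1; split => //; split.
    by case: (n) => // m; rewrite ltnS (leq_trans (leqnSn m)) // leq_pmulr.
  move=> A _ H; have := leq_trans H (nsym_le A); by rewrite ltnn.
have [l [Pl Hl]] : exists l, P l /\ forall k, P k -> l <= k.
  case: (dec_inh_nat_subset_has_unique_least_element P
          (fun k => classic (P k)) ex) => l [[Pl Hl] _].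
  by exists l; split => // k Pk; apply/ssrnat.leP; apply: Hl.
case: Pl => [l0 [nl gl]]; exists l; split => // k k0 nk gk; exact: Hl.
Qed.

Definition lr (n : nat) : nat :=
  proj1_sig (constructive_indefinite_description _ (lr_exists n)).

(* Main.v *)
Require Import Defs.
From HB Require Import structures.
From mathcomp Require Import all_boot all_order all_algebra all_field.
From mathcomp Require Import all_fingroup zify ring lra realalg.
From Stdlib Require Import Classical ClassicalEpsilon.
Import Order.TTheory GRing.Theory Num.Theory.
Set Implicit Arguments. Unset Strict Implicit. Unset Printing Implicit Defensive.

(** Let [q = (3 - sqrt 5) / 2], so that [(1 - q)^2 = q] and the threshold is
    [(1 + q) / 2 * n^2]. Take a counterexample of least order [n] and, for that
    order, with the most symbols; it has at least [q n^2] singletons (symbols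
    occurring once). Giving a repeated cell (a clone) a fresh symbol creates a
    transversal, so every clone [(i, j)] is the only defect of some diagonal [p]
    with [p i = j]; swapping along [p] shows that row [i] and column [j] hold
    fewer than [n] singletons in total. Deleting the row and column of a singleton
    loses many symbols, hence these hold together almost [(1 + q) n] singletons.

    Choose [j], among the columns not filled with singletons, with the most
    singletons, [t] say, and a clone [(i, j)] with its diagonal [p]. If no column is
    full, the singletons of column [j] and the cells of row [i] whose symbols
    avoid [p] span a large region that carries only symbols of [p]. If [f > 0]
    columns are full, then [f] is almost [q n], the rows that [p] matches to full
    columns are free to be used elsewhere, and Drisko's augmentation argument
    gives such a region, or a transversal. The symbols of the region are repeated
    outside of it, and counting symbols contradicts the choice of [q]. *)

(** * Singletons and counting *)

Definition symbols n (A : array n) : seq nat :=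
  undup [seq A i j | i <- enum 'I_n, j <- enum 'I_n].

Definition single n (A : array n) (i j : 'I_n) : bool :=
  [forall c : 'I_n * 'I_n, (A c.1 c.2 == A i j) ==> (c == (i, j))].

Definition row_singles n (A : array n) i := [set y | single A i y].
Definition col_singles n (A : array n) j := [set x | single A x j].
Definition nsingle n (A : array n) := #|[set c | single A c.1 c.2]|.

Definition perm_transversal n (A : array n) (p : 'S_n) : Prop :=
  injective (fun x => A x (p x)).

Definition near_transversal n (A : array n) (p : 'S_n) (i : 'I_n) : Prop :=
  {in predC1 i &, injective (fun x => A x (p x))}.

Section Basics.
Variables (n : nat) (A : array n).

Lemma mem_symbols i j : A i j \in symbols A.
Proof. by rewrite mem_undup; apply: allpairs_f; rewrite mem_enum. Qed.

Lemma symbolsP k : reflect (exists i j, k = A i j) (k \in symbols A).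
Proof.
apply: (iffP idP) => [|[i [j ->]]]; last exact: mem_symbols.
by rewrite mem_undup => /allpairsP[[i j] /= [_ _ ->]]; exists i, j.
Qed.

Lemma singleP i j :
  reflect (forall x y, A x y = A i j -> x = i /\ y = j) (single A i j).
Proof.
apply: (iffP forallP) => [H x y e|H [x y]].
  by move: (H (x, y)); rewrite /= e eqxx => /eqP[-> ->].
by apply/implyP => /= /eqP/H[-> ->].
Qed.

Lemma not_singleP i j :
  ~~ single A i j -> exists x y, A x y = A i j /\ (x, y) != (i, j).
Proof.
by rewrite negb_forall => /existsP[[x y]]; rewrite negb_imply => /andP[/eqP e H]; exists x, y.
Qed.

Lemma clone_of_repeat i j x y :
  A x y = A i j -> (x, y) != (i, j) -> ~~ single A i j.
Proof. by move=> e; apply: contra => /singleP/(_ _ _ e)[-> ->]. Qed.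

Lemma nsym_leq (s : seq nat) :
  (forall i j, A i j \in s) -> nsym A <= size s.
Proof.
by move=> H; apply: uniq_leq_size (undup_uniq _) _ => _ /symbolsP[i [j ->]].
Qed.

Lemma nsym_cover (P : {set 'I_n * 'I_n}) (Z : seq nat) :
  (forall i j, A i j \in Z \/ exists2 c, c \in P & A c.1 c.2 = A i j) ->
  nsym A <= #|P| + size Z.
Proof.
move=> H; rewrite cardE -(size_map (fun c => A c.1 c.2)) -size_cat.
apply: nsym_leq => i j; rewrite mem_cat.
case: (H i j) => [->|[c cP <-]]; first by rewrite orbT.
by rewrite (map_f (fun c => A c.1 c.2)) // mem_enum.
Qed.

Lemma perm_transversalW p : perm_transversal A p -> has_transversal A.
Proof.
move=> inj; exists [set (x, p x) | x in 'I_n]; split.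
  by rewrite card_imset ?card_ord // => x y [].
move=> _ _ /imsetP[x _ ->] /imsetP[y _ ->] /= ne.
have {}ne : x != y by apply: contraNneq ne => ->.
by split=> //; [rewrite (inj_eq perm_inj) | rewrite (inj_eq inj)].
Qed.

Lemma has_transversal_perm :
  has_transversal A -> exists p, perm_transversal A p.
Proof.
move=> [T [cT sT]].
have injT : {in T &, injective fst}.
  by move=> e f eT fT ef; apply: contra_eq ef => /(sT e f eT fT)[].
have fullT : fst @: T = setT.
  by apply/eqP; rewrite eqEcard subsetT cardsT card_ord (card_in_imset injT) cT /=.
have gP x : exists y, (x, y) \in T.
  have: x \in fst @: T by rewrite fullT inE.
  by case/imsetP=> -[x' y] yT /= ->; exists y.
pose g x := xchoose (gP x).
have gT x : (x, g x) \in T := xchooseP (gP x).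
have dist x y : x != y -> g x != g y /\ A x (g x) != A y (g y).
  move=> ne; have nf : (x, g x) != (y, g y) by apply: contraNneq ne => -[->].
  by case: (sT _ _ (gT x) (gT y) nf).
have ginj : injective g.
  by move=> x y e; apply: contra_eq e => /dist[].
exists (perm ginj) => x y; rewrite !permE => e.
by apply: contra_eq e => /dist[].
Qed.

Lemma near_extend p i :
  near_transversal A p i ->
  (forall x, x != i -> A x (p x) != A i (p i)) -> has_transversal A.
Proof.
move=> near ne; apply: (@perm_transversalW p) => x y.
have [-> | xi] := eqVneq x i; have [-> | yi] := eqVneq y i => // e.
- by have:= ne y yi; rewrite e eqxx.
- by have:= ne x xi; rewrite e eqxx.
- exact: near.
Qed.

(* Counting each symbol once by a representative outside [Rg], once more by
   another cell outside [Rg] unless it is a singleton or one of [Z]. *)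
Lemma double_count (Rg : {set 'I_n * 'I_n}) (Z : seq nat) :
  (forall c, c \in Rg -> A c.1 c.2 \in Z) ->
  (forall k, k \in Z -> exists2 c, c \notin Rg & A c.1 c.2 = k) ->
  2 * nsym A + #|Rg| <= n * n + nsingle A + size Z.
Proof.
move=> RgZ ZRg; pose f c := A c.1 c.2.
(* [pick] sees only the symbol of [c], so [rep] chooses one cell per symbol outside [Rg]; the
   default [c] is never reached there. *)
pose rep c := odflt c [pick d | (d \notin Rg) && (f d == f c)].
have repP c : c \notin Rg -> (rep c \notin Rg) && (f (rep c) == f c).
  by rewrite /rep => cR; case: pickP => [//|/(_ c)]; rewrite cR eqxx.
have repE c d : c \notin Rg -> d \notin Rg -> f c = f d -> rep c = rep d.
  move=> cR dR e; rewrite /rep (@eq_pick _ _ (fun x => (x \notin Rg) && (f x == f d))).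
    by case: pickP => //= /(_ d); rewrite dR eqxx.
  by move=> x; rewrite e.
pose P := rep @: ~: Rg; pose Q := ~: (P :|: Rg).
have dPR : [disjoint P & Rg].
  apply/pred0P => c /=; apply/negP => /andP[/imsetP[d]].
  by rewrite inE => /repP/andP[dR _] -> /(negP dR).
have tot : #|P| + #|Rg| + #|Q| = n * n.
  have := cardsC (P :|: Rg); rewrite card_prod !card_ord cardsU.
  by move: dPR; rewrite -setI_eq0 => /eqP ->; rewrite cards0 subn0.
have out k : k \in symbols A -> exists2 c, c \notin Rg & f c = k.
  case/symbolsP=> i [j ->]; case: (boolP ((i, j) \in Rg)) => [/RgZ/ZRg //|H].
  by exists (i, j).
have leP : nsym A <= #|P|.
  rewrite -[#|P|]addn0; apply: (@nsym_cover P [::]) => i j; right.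
  have [c cR <-] := out _ (mem_symbols i j).
  have /andP[_ /eqP fc] := repP c cR; exists (rep c) => //.
  by apply: imset_f; rewrite inE.
have leQ : nsym A <= #|[set c | single A c.1 c.2] :|: Q| + size Z.
  apply: nsym_cover => i j.
  case: (boolP (A i j \in Z)) => [H|nZ]; [by left | right].
  case: (boolP (single A i j)) => [sij|/not_singleP[x [y [e ne]]]].
    by exists (i, j); rewrite // !inE sij.
  have notR u v : A u v = A i j -> (u, v) \notin Rg.
    by move=> e'; apply: contra nZ => /RgZ /=; rewrite e'.
  suff [c cQ ce] : exists2 c, c \in Q & f c = A i j.
    by exists c => //; rewrite inE cQ orbT.
  (* A symbol outside [Z] has all its cells outside [Rg]. If it is repeated, only one of them is its
     representative, so another lies in [Q]. *)
  have inQ u v : A u v = A i j -> (u, v) != rep (i, j) -> (u, v) \in Q.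
    move=> e' ne'; rewrite !inE (negPf (notR _ _ e')) orbF.
    apply: contra ne' => /imsetP[d]; rewrite inE => dR ed.
    have /andP[_ /eqP fd] := repP d dR; rewrite ed (repE d (i, j)) ?notR //.
    by rewrite -fd -ed.
  have [er|nr] := eqVneq (i, j) (rep (i, j)); last by exists (i, j); rewrite ?inQ.
  by exists (x, y) => //; apply: inQ => //; rewrite -er.
have [le _] := leq_card_setU [set c | single A c.1 c.2] Q; rewrite /nsingle; lia.
Qed.

Lemma nsingle_lower : 2 * nsym A <= n * n + nsingle A.
Proof.
have := @double_count set0 [::]; rewrite cards0 !addn0; apply => // c.
by rewrite inE.
Qed.

Lemma card_cells_sum (P : 'I_n -> 'I_n -> bool) :
  #|[set c | P c.1 c.2]| = \sum_y #|[set x | P x y]|.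
Proof.
under eq_bigr => y _ do rewrite -sum1dep_card.
rewrite -sum1dep_card (exchange_big_dep xpredT) //= pair_big_dep /=.
by apply: eq_bigl => -[].
Qed.

Lemma nsingle_sum : nsingle A = \sum_y #|col_singles A y|.
Proof. exact: card_cells_sum. Qed.

End Basics.

(** * Extremal counterexamples *)

Lemma swap_permE n (p : 'S_n) (u v x : 'I_n) :
  (tperm u v * p)%g x = if x == u then p v else if x == v then p u else p x.
Proof.
rewrite permM; case: tpermP => [->|->|/eqP/negPf-> /eqP/negPf->]; rewrite ?eqxx //.
by case: eqP => [->|].
Qed.

(* The repeated symbols that vanish with row [i] and column [j], encoded by their
   columns in row [i] (see [clone_far] for why they meet that row). *)
Definition mixed n (A : array n) (i j : 'I_n) :=
  [set y | ~~ single A i y &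
    [forall c : 'I_n * 'I_n, (A c.1 c.2 == A i y) ==> (c.1 == i) || (c.2 == j)]].

Definition delete m (A : array m.+1) (i j : 'I_m.+1) : array m :=
  fun x y => A (lift i x) (lift j y).

Lemma delete_latin m (A : array m.+1) i j : row_latin A -> row_latin (delete A i j).
Proof. by move=> lat x y z /lat/lift_inj. Qed.

Lemma delete_single m (A : array m.+1) i j :
  single A i j -> has_transversal (delete A i j) -> has_transversal A.
Proof.
move=> /singleP sij /has_transversal_perm[p inj].
apply: (@perm_transversalW _ _ (lift_perm i j p)) => x y.
case: (unliftP i x) => [x'|] ->; case: (unliftP i y) => [y'|] ->;
  rewrite ?lift_perm_lift ?lift_perm_id.
- by move/inj->.
- by case/sij.
- by move/esym/sij; case.
- by [].
Qed.

(** * Clones in a counterexample with the most symbols *)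

Section Critical.
Variables (n : nat) (A : array n).
Hypothesis latA : row_latin A.
Hypothesis noT : ~ has_transversal A.
Hypothesis maxA : forall B : array n, row_latin B -> nsym A < nsym B -> has_transversal B.

Lemma near_repeat p i :
  near_transversal A p i -> exists2 x, x != i & A x (p x) = A i (p i).
Proof.
move=> near; case: (boolP [exists x, (x != i) && (A x (p x) == A i (p i))]).
  by case/existsP=> x /andP[xi /eqP e]; exists x.
rewrite negb_exists => /forallP H; case: noT; apply: near_extend near _ => x xi.
by move: (H x); rewrite xi.
Qed.

(* Maximality is applied to [A] with a fresh symbol in the cell [(i, j)]. *)
Lemma clone_near i j :
  ~~ single A i j -> exists p : 'S_n, p i = j /\ near_transversal A p i.
Proof.
move=> nij; pose k := (\max_(l <- symbols A) l).+1.
have fresh x y : A x y != k.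
  by rewrite neq_ltn ltnS leq_bigmax_seq // mem_symbols.
pose B : array n := fun x y => if (x, y) == (i, j) then k else A x y.
have latB : row_latin B.
  move=> x y z; rewrite /B !xpair_eqE.
  case: (x =P i) => [->|_] /=; last exact: latA.
  case: eqP => [->|_]; case: eqP => [->|_] //; last exact: latA.
    by move/esym/eqP; rewrite (negPf (fresh _ _)).
  by move/eqP; rewrite (negPf (fresh _ _)).
have ltB : nsym A < nsym B.
  apply: (@uniq_leq_size _ (k :: symbols A)).
    rewrite /= undup_uniq andbT; apply/symbolsP=> -[x [y e]].
    by have:= fresh x y; rewrite e eqxx.
  move=> l; rewrite inE => /orP[/eqP->|/symbolsP[x [y ->]]].
    by apply/symbolsP; exists i, j; rewrite /B eqxx.
  have [e|ne] := eqVneq (x, y) (i, j); last first.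
    by apply/symbolsP; exists x, y; rewrite /B (negPf ne).
  have [u [v [euv ne]]] := not_singleP nij.
  by apply/symbolsP; exists u, v; rewrite /B (negPf ne) euv; case: e => -> ->.
have [p inj] := has_transversal_perm (maxA latB ltB).
have BE x : x != i -> B x (p x) = A x (p x).
  by move=> ne; rewrite /B xpair_eqE (negPf ne).
exists p; split; last first.
  by move=> x y; rewrite !inE => xi yi /=; rewrite -!BE // => /inj.
(* If [p] missed the altered cell, it would be a transversal of [A] itself. *)
apply/eqP/negPn/negP => ne; apply: noT; apply: (@perm_transversalW _ _ p).
move=> x y e; apply: inj; move: e; rewrite /B !xpair_eqE.
have [-> | _] := eqVneq x i; have [-> | _] := eqVneq y i; rewrite /= ?(negPf ne) //.
Qed.

(** The defect of the diagonal through [(i, j)] must be a repetition, and the other cell of the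
    diagonal with that symbol shares neither row nor column. *)
Lemma clone_far i j :
  ~~ single A i j -> exists x y : 'I_n, [/\ x != i, y != j & A x y = A i j].
Proof.
case/clone_near=> p [<- /near_repeat[x xi e]].
by exists x, (p x); split; rewrite ?(inj_eq perm_inj).
Qed.

(** If both crossing cells were singletons, swapping rows [i] and [x] would give a diagonal whose
    only possible defect is a singleton, against [near_repeat]. *)
Lemma near_single_swap p i x :
  near_transversal A p i -> x != i -> single A x (p i) -> ~~ single A i (p x).
Proof.
move=> near xi sx; apply/negP => si; pose q := (tperm i x * p)%g.
have qi : q i = p x by rewrite swap_permE eqxx.
have qx : q x = p i by rewrite swap_permE (negPf xi) eqxx.
have nearq : near_transversal A q x.
  move=> y z; rewrite !inE => yx zx /=.
  have [-> | yi] := eqVneq y i; have [-> | zi] := eqVneq z i => //.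
  - by rewrite qi => /esym; case/(singleP _ _ _ si) => ->.
  - by rewrite qi; case/(singleP _ _ _ si) => ->.
  - rewrite /q !swap_permE (negPf yi) (negPf zi) (negPf yx) (negPf zx).
    exact: near.
have [y yx] := near_repeat nearq; rewrite qx.
by case/(singleP _ _ _ sx) => yE; rewrite yE eqxx in yx.
Qed.

(** Let [p] be the diagonal exposing [(i, j)]. The rows [x] with [(i, p x)] a singleton and those
    with [(x, j)] a singleton are disjoint by [near_single_swap], and neither set contains [i]. *)
Lemma clone_degrees i j :
  ~~ single A i j -> #|row_singles A i| + #|col_singles A j| < n.
Proof.
move=> nij; have [p [pi near]] := clone_near nij.
pose S := [set x | single A i (p x)].
have -> : #|row_singles A i| = #|S|.
  rewrite -(card_imset _ (@perm_inj _ p)); congr #|pred_of_set _|.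
  apply/setP => y; rewrite inE; apply/idP/imsetP => [sy|[x + ->]]; last by rewrite inE.
  by exists ((p^-1)%g y); rewrite ?inE permKV.
have dis : S :&: col_singles A j = set0.
  apply/setP => x; rewrite !inE; apply/negP => /andP[sx sj].
  have [e|xi] := eqVneq x i; first by rewrite e (negPf nij) in sj.
  by rewrite -pi in sj; rewrite (negPf (near_single_swap near xi sj)) in sx.
have : S :|: col_singles A j \subset ~: [set i].
  apply/subsetP => x; rewrite !inE; apply: contraTneq => ->.
  by rewrite pi orbb.
move/subset_leq_card; rewrite cardsU dis cards0 subn0 cardsC1 card_ord.
by move/leq_ltn_trans; apply; rewrite ltn_predL (leq_ltn_trans _ (ltn_ord i)).
Qed.

(** By [clone_far] each mixed symbol recurs off row [i], hence in column [j], in a cell that is no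
    singleton. Row [i] being Latin, these cells are distinct. *)
Lemma card_mixed_col i j : #|col_singles A j| + #|mixed A i j| <= n.
Proof.
have fP y : exists x, (y \in mixed A i j) ==> (A x j == A i y) && ~~ single A x j.
  case: (boolP (y \in mixed A i j)) => [|_]; last by exists i.
  rewrite inE => /andP[ny /forallP H]; have [u [v [ui vy e]]] := clone_far ny.
  exists u; move: (H (u, v)); rewrite /= e eqxx (negPf ui) /= => /eqP <-.
  by rewrite e eqxx; apply: clone_of_repeat (esym e) _; rewrite xpair_eqE eq_sym (negPf ui).
pose f y := xchoose (fP y).
have fE y : y \in mixed A i j -> A (f y) j = A i y /\ ~~ single A (f y) j.
  by move=> yM; have /implyP/(_ yM)/andP[/eqP] := xchooseP (fP y).
have inj : {in mixed A i j &, injective f}.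
  move=> y z /fE[ey _] /fE[ez _] e; apply: (latA (i := i)).
  by rewrite -ey -ez e.
rewrite -(card_in_imset inj).
have : f @: mixed A i j \subset ~: col_singles A j.
  by apply/subsetP => _ /imsetP[y /fE[_ ny] ->]; rewrite !inE.
move/subset_leq_card; have := cardsC (col_singles A j); rewrite card_ord; lia.
Qed.

(** A clone [(i, y)] is mixed for at most one [j]: the column of the far copy given by
    [clone_far]. *)
Lemma sum_mixed_row i :
  #|row_singles A i| + \sum_(j in row_singles A i) #|mixed A i j| <= n.
Proof.
suff: \sum_(j in row_singles A i) #|mixed A i j| <= #|~: row_singles A i|.
  by have := cardsC (row_singles A i); rewrite card_ord; lia.
under eq_bigr => j _ do rewrite -sum1_card.
rewrite (exchange_big_dep (fun y => y \in ~: row_singles A i)) /=; last first.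
  by move=> j y _; rewrite !inE => /andP[].
rewrite -sum1_card leq_sum // => y ny; rewrite sum1dep_card.
apply/card_le1_eqP => j k; rewrite !inE.
case/andP=> sj /andP[cy /forallP Hj] /andP[sk /andP[_ /forallP Hk]].
have [u [v [ui _ e]]] := clone_far cy.
move: (Hj (u, v)) (Hk (u, v)); rewrite /= e eqxx (negPf ui) /=.
by move=> /eqP<- /eqP<-.
Qed.

End Critical.

(** A vanishing symbol is a singleton of row [i] or column [j], or a repeated symbol. A repeated one
    meets row [i], since its copies cannot all lie in column [j]. The inequality is strict because
    [(i, j)] is a singleton of both lines. *)
Lemma nsym_delete m (A : array m.+1) i j :
  (forall x y, ~~ single A x y -> exists u v : 'I_m.+1, [/\ u != x, v != y & A u v = A x y]) ->
  single A i j ->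
  nsym A < nsym (delete A i j) + #|row_singles A i| + #|col_singles A j| + #|mixed A i j|.
Proof.
move=> far sij.
have iC : i \in col_singles A j by rewrite inE.
rewrite (cardsD1 i (col_singles A j)) iC.
suff: nsym A <= size (symbols (delete A i j) ++ map (A i) (enum (row_singles A i)) ++
   map (A^~ j) (enum (col_singles A j :\ i)) ++ map (A i) (enum (mixed A i j))).
  rewrite !size_cat !size_map -!cardE /nsym -!/(symbols _) /=; lia.
apply: nsym_leq => x y; rewrite !mem_cat.
case: (boolP (A x y \in symbols (delete A i j))) => //= nd.
have cross u v : A u v = A x y -> (u == i) || (v == j).
  move=> e; apply: contraNT nd; rewrite negb_or => /andP[ui vj].
  move: ui vj; rewrite eq_sym [v == j]eq_sym => /unlift_some[u' eu _] /unlift_some[v' ev _].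
  by apply/symbolsP; exists u', v'; rewrite /delete -eu -ev.
case: (boolP (single A x y)) => [sxy|cxy].
  case/orP: (cross x y erefl) => /eqP e.
    by apply/orP; left; rewrite e map_f // mem_enum inE -e.
  have [xi|xi] := eqVneq x i.
    by apply/orP; left; rewrite xi map_f // mem_enum inE -xi.
  apply/orP; right; apply/orP; left; rewrite e (map_f (A^~ j)) // mem_enum !inE xi /=.
  by rewrite -e.
have mix v : A i v = A x y -> A x y \in map (A i) (enum (mixed A i j)).
  move=> e; rewrite -e map_f // mem_enum inE; apply/andP; split.
    have [u [w [ux wy euw]]] := far _ _ cxy; have [xi|xi] := eqVneq x i.
      by apply: (@clone_of_repeat _ _ _ _ u w); rewrite ?e // xpair_eqE -xi (negPf ux).
    by apply: (@clone_of_repeat _ _ _ _ x y); rewrite ?e // xpair_eqE (negPf xi).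
  apply/forallP => c; apply/implyP => /eqP ec; apply: cross; rewrite ec; exact: e.
case/orP: (cross x y erefl) => /eqP e.
  by rewrite (mix y) ?orbT // e.
have [u [w [ux wy euw]]] := far _ _ cxy.
case/orP: (cross u w euw) => /eqP e'.
  by rewrite (mix w) ?orbT // -e'.
by rewrite e e' eqxx in wy.
Qed.

(** * Near transversals *)

Section NearTransversal.
Variables (n : nat) (A : array n).
Hypothesis latA : row_latin A.
Hypothesis noT : ~ has_transversal A.

Lemma swap_near (p : 'S_n) (i y : 'I_n) :
  near_transversal A p i -> y != i ->
  (forall z, z != i -> z != y -> A z (p z) != A i (p y)) ->
  near_transversal A (tperm i y * p)%g y.
Proof.
move=> near yi new u v; rewrite !inE => uy vy /=; rewrite !swap_permE (negPf uy) (negPf vy).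
have [-> | ui] := eqVneq u i; have [-> | vi] := eqVneq v i => // e.
- by have := new v vi vy; rewrite e eqxx.
- by have := new u ui uy; rewrite e eqxx.
- exact: near.
Qed.

(* Row [x] takes over column [p i] through a singleton, which releases column
   [p x] to row [i]. *)
Lemma single_swap_near (p : 'S_n) i x :
  near_transversal A p i -> x != i -> single A x (p i) ->
  near_transversal A (tperm i x * p)%g i.
Proof.
move=> near xi sx u v; rewrite !inE => ui vi /=.
rewrite !swap_permE (negPf ui) (negPf vi).
have [-> | ux] := eqVneq u x; have [-> | vx] := eqVneq v x => //=.
- by move/esym; case/(singleP _ _ _ sx) => ->.
- by case/(singleP _ _ _ sx) => ->.
- exact: near.
Qed.

Lemma single_swap_used (p : 'S_n) i x :
  near_transversal A p i -> x != i -> single A x (p i) ->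
  exists z, [/\ z != i, z != x & A z (p z) = A i (p x)].
Proof.
move=> near xi sx.
have [z zi] := near_repeat noT (single_swap_near near xi sx).
rewrite !swap_permE eqxx (negPf zi) => e; exists z; split=> //.
  apply: contraNneq xi => zx; move: e; rewrite zx eqxx => /esym.
  by case/(singleP _ _ _ sx) => ->.
move: e; case: eqP => [->|//] /esym.
by case/(singleP _ _ _ sx) => e _; rewrite e eqxx in xi.
Qed.

Variables (p : 'S_n) (i : 'I_n).
Hypothesis near : near_transversal A p i.
Hypothesis clone_i : ~~ single A i (p i).

Definition used k := [exists x, (x != i) && (A x (p x) == k)].
Definition clone_rows := [set x | (x != i) && ~~ single A x (p x)].

Local Notation I := (col_singles A (p i)).
Local Notation K := clone_rows.
Local Notation tau := #|I|.
Local Notation kappa := #|K|.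

Lemma usedP k : reflect (exists2 x, x != i & A x (p x) = k) (used k).
Proof.
apply: (iffP existsP) => [[x /andP[xi /eqP e]]|[x xi <-]]; exists x => //.
by rewrite xi eqxx.
Qed.

Lemma used_clone_rows x y v :
  x != i -> A x (p x) = A y v -> (y, v) != (x, p x) -> x \in K.
Proof. by move=> xi e ne; rewrite inE xi; apply: clone_of_repeat (esym e) ne. Qed.

Lemma card_clone_rows : (kappa + #|[set x | single A x (p x)]|).+1 = n.
Proof.
have KE : K = ~: [set x | single A x (p x)] :\ i by apply/setP => x; rewrite !inE.
have := cardsC [set x | single A x (p x)].
rewrite KE card_ord (cardsD1 i (~: _)) !inE clone_i; lia.
Qed.

(** This is [double_count] with [Z] the symbols of [p] on its clone rows: a symbol of the region
    also occurs on [p], which avoids the region, so it is repeated. *)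
Lemma region_bound (Rg : {set 'I_n * 'I_n}) :
  (forall c, c \in Rg -> used (A c.1 c.2)) ->
  (forall x, x != i -> (x, p x) \notin Rg) ->
  2 * nsym A + #|Rg| <= n * n + nsingle A + kappa.
Proof.
move=> RgU RgN; pose Z := [seq A x (p x) | x <- enum K].
have <- : size Z = kappa by rewrite size_map -cardE.
apply: double_count.
  move=> c cR; have /usedP[x xi e] := RgU c cR; apply/mapP; exists x => //.
  rewrite mem_enum; apply: (used_clone_rows xi e).
  by apply: contraNneq (RgN x xi) => <-; case: (c) cR.
move=> k /mapP[x]; rewrite mem_enum inE => /andP[xi _] ->.
by exists (x, p x); rewrite ?RgN.
Qed.

Local Notation N := [set x | used (A i (p x))].

(** Send [x] to the row where [p] carries the symbol of [(i, p x)]. That symbol is repeated, so the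
    image is a clone row, and row [i] being Latin makes the map injective. *)
Lemma card_used_row : #|N| <= kappa.
Proof.
have fP x : exists z, (x \in N) ==> (z != i) && (A z (p z) == A i (p x)).
  case: (boolP (x \in N)) => [|_]; last by exists i.
  by rewrite inE => /usedP[z zi e]; exists z; rewrite zi e eqxx.
pose f x := xchoose (fP x).
have fE x : x \in N -> f x != i /\ A (f x) (p (f x)) = A i (p x).
  by move=> xN; have /implyP/(_ xN)/andP[? /eqP] := xchooseP (fP x).
have inj : {in N &, injective f}.
  move=> x y /fE[_ ex] /fE[_ ey] e; apply: (@perm_inj _ p); apply: (latA (i := i)).
  by rewrite -ex -ey e.
rewrite -(card_in_imset inj) subset_leq_card //.
apply/subsetP => _ /imsetP[x /fE[fi e] ->]; apply: (used_clone_rows fi e).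
by rewrite xpair_eqE eq_sym (negPf fi).
Qed.

Lemma single_col_used x : x \in i |: I -> used (A i (p x)).
Proof.
rewrite !inE => /orP[/eqP->|sx]; first by apply/usedP; apply: near_repeat.
have xi : x != i by apply: contraTneq sx => ->.
by have [z [zi _ e]] := single_swap_used near xi sx; apply/usedP; exists z.
Qed.

Lemma card_col_single_lt : tau < kappa.
Proof.
apply: leq_trans card_used_row; have: i |: I \subset N.
  by apply/subsetP => x /single_col_used; rewrite inE.
by move/subset_leq_card; rewrite cardsU1 !inE clone_i.
Qed.

Lemma free_row_used y x :
  y \notin N -> x \in i |: I -> used (A y (p x)) \/ A y (p x) = A i (p y).
Proof.
rewrite inE => yN xI.
have yi : y != i by apply: contraNneq yN => ->; apply: single_col_used; rewrite !inE eqxx.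
have nearq : near_transversal A (tperm i y * p)%g y.
  apply: swap_near => // z zi _; apply: contraNneq yN => e; apply/usedP; by exists z.
set q := (_ * p)%g in nearq.
have qE z : z != y -> A z (q z) = A y (p x) -> used (A y (p x)) \/ A y (p x) = A i (p y).
  rewrite swap_permE => zy; have [-> /esym|zi] := eqVneq z i; first by right.
  by rewrite (negPf zy) => e; left; apply/usedP; exists z.
have qy : q y = p i by rewrite swap_permE (negPf yi) eqxx.
have xy : x != y by apply: contraNneq yN => <-; apply: single_col_used.
move: xI; rewrite !inE; have [xi _|xi /= sx] := eqVneq x i.
  by have [z zy e] := near_repeat noT nearq; apply: (qE z) => //; rewrite e qy xi.
rewrite -qy in sx; have [z [zy zx e]] := single_swap_used nearq xy sx.
by apply: (qE z) => //; rewrite e swap_permE (negPf xi) (negPf xy).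
Qed.

(** The region lies over the columns [p @: (i |: I)], in row [i] and the rows outside [N]. Row [i]
    contributes all its [tau.+1] cells. Every other row loses at most the one cell with the
    exceptional symbol of [free_row_used]. As [i |: I] is contained in [N], [p] avoids the region
    off row [i]. *)
Lemma row_region_bound :
  2 * nsym A + (n - kappa) * tau + tau.+1 <= n * n + nsingle A + kappa.
Proof.
pose C := p @: (i |: I).
have cC : #|C| = tau.+1.
  by rewrite card_imset ?cardsU1 ?inE ?clone_i //; apply: perm_inj.
pose P u v := [&& u \in i |: ~: N, v \in C & used (A u v)].
have := @region_bound [set c | P c.1 c.2].
have le : (n - kappa) * tau + tau.+1 <= #|[set c | P c.1 c.2]|.
  have -> : #|[set c | P c.1 c.2]| = \sum_u #|[set v | P u v]|.
    under eq_bigr => u _ do rewrite -sum1dep_card.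
    rewrite pair_big_dep /= sum1dep_card; exact: eq_card.
  rewrite (bigD1 i) //= addnC leq_add //.
    rewrite -cC subset_leq_card //; apply/subsetP => v vC.
    rewrite inE /P vC !inE eqxx /=; case/imsetP: vC => x xI ->; exact: single_col_used.
  have cN : n - kappa <= #|~: N|.
    by have := cardsC N; have := card_used_row; rewrite card_ord; lia.
  apply: (@leq_trans (\sum_(u in ~: N) tau)).
    by rewrite sum_nat_const leq_mul2r cN orbT.
  rewrite big_mkcond [leqRHS]big_mkcond leq_sum //= => u _.
  case: ifP => // uN; case: eqP => [ui|_].
    by move: uN; rewrite !inE ui single_col_used // !inE eqxx.
  rewrite -ltnS -cC -(cardsID [set v | P u v] C) -addn1 leq_add //.
    by rewrite subset_leq_card // subsetIr.
  apply/card_le1_eqP => v w; rewrite !inE /P.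
  suff: forall v, (v \in C) && ~~ [&& u \in i |: ~: N, v \in C & used (A u v)] ->
          A u v = A i (p u).
    by move=> H; rewrite ![_ && (_ \in C)]andbC => /H ev /H; rewrite -ev => /latA->.
  move=> {}v /andP[vC]; rewrite vC !inE in uN *.
  rewrite uN orbT /=; case/imsetP: vC => x xI -> nu.
  by case: (@free_row_used u x) => //; [rewrite inE|move=> e; rewrite e in nu].
move=> H; suff: 2 * nsym A + #|[set c | P c.1 c.2]| <= n * n + nsingle A + kappa by lia.
apply: H => [c|x xi]; rewrite inE /P; first by case/and3P.
apply/negP => /and3P[]; rewrite !inE (negPf xi) /= => xN.
rewrite /C mem_imset; last exact: perm_inj.
by move/single_col_used; rewrite (negPf xN).
Qed.

End NearTransversal.

(** At least [#|X| + #|G| - n] rows of [X] are matched by [p] into [G], each at a singleton. *)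
Lemma rectangle_singles n (A : array n) (p : 'S_n) (X G : {set 'I_n}) :
  {in X & G, forall x y, single A x y} ->
  #|X| + #|G| <= n + #|[set x | single A x (p x)]|.
Proof.
move=> sXG; pose Y := [set x | p x \in G].
have <- : #|Y| = #|G|.
  rewrite -(card_imset _ (@perm_inj _ p)); apply: eq_card => y.
  apply/imsetP/idP => [[x + ->]|yG]; first by rewrite inE.
  by exists ((p^-1)%g y); rewrite ?inE permKV.
have : X :&: Y \subset [set x | single A x (p x)].
  by apply/subsetP => x; rewrite !inE => /andP[xX /sXG]; apply.
move/subset_leq_card; have := cardsUI X Y; have := subset_leq_card (subsetT (X :|: Y)).
rewrite cardsT card_ord /reverse_coercion; lia.
Qed.

(** * Columns full of singletons *)

Section FullColumns.
Variables (n : nat) (A : array n).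
Hypothesis latA : row_latin A.
Hypothesis noT : ~ has_transversal A.
Variables (p : 'S_n) (i : 'I_n).
Hypothesis near : near_transversal A p i.
Hypothesis clone_i : ~~ single A i (p i).
Variable F : {set 'I_n}.
Hypothesis fullF : forall x y, y \in F -> single A x y.

Local Notation I := (col_singles A (p i)).

(* Rows that can be parked in full columns, hence are free to be placed in any
   other column. *)
Definition spare_rows := i |: [set x | p x \in F].
Local Notation U := spare_rows.

Definition used_in (C : {set 'I_n}) k := [exists x, [&& x != i, p x \in C & A x (p x) == k]].

(* Column [c] can be exposed by a near transversal that differs from [p] only in
   the columns of [C] and [F], uses on [C] only the symbols of [p] there and
   singletons, and leaves the spare rows outside [D] unplaced. *)
Definition exposable (C : {set 'I_n}) (D : seq 'I_n) c :=
  exists (s : 'S_n) (v : 'I_n),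
  [/\ s v = c,
      near_transversal A s v,
      forall w, w \in U -> w \notin D -> w = v \/ s w \in F,
      forall x, p x \notin C -> p x \notin F -> s x = p x &
      forall x, x != v -> s x \in C -> used_in C (A x (s x)) \/ single A x (s x)].

Lemma used_inP (C : {set 'I_n}) k :
  reflect (exists x, [/\ x != i, p x \in C & A x (p x) = k]) (used_in C k).
Proof.
apply: (iffP existsP) => [[x /and3P[xi xC /eqP e]]|[x [xi xC <-]]]; exists x => //.
by rewrite xi xC eqxx.
Qed.

Lemma used_inS (C C' : {set 'I_n}) k : C \subset C' -> used_in C k -> used_in C' k.
Proof.
move=> /subsetP sC /used_inP[x [xi xC e]]; apply/used_inP; exists x; split=> //.
exact: sC.
Qed.

Lemma used_in_used (C : {set 'I_n}) k : used_in C k -> used A p i k.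
Proof. by case/used_inP=> x [xi _ e]; apply/usedP; exists x. Qed.

Lemma exposed_not_full : p i \notin F.
Proof. by apply: contra clone_i => /(fullF i). Qed.

Lemma exposable_weaken (C : {set 'I_n}) D c u r :
  r != i -> p r \notin C -> p r \notin F -> c \in C ->
  exposable C D c -> exposable (p r |: C) (u :: D) c.
Proof.
move=> ri rC rF cC [s [v [sv nears spare agree sym]]]; exists s, v; split=> //.
- by move=> w wU; rewrite inE negb_or => /andP[_]; apply: spare.
- by move=> x; rewrite !inE negb_or => /andP[_]; apply: agree.
move=> x xv; rewrite !inE => /orP[/eqP sx|sxC]; last first.
  case: (sym x xv sxC) => [H|]; [left | by right].
  by apply: used_inS H; apply: subsetUr.
have xr : x = r by apply: (@perm_inj _ s); rewrite sx agree.
by left; apply/used_inP; exists r; rewrite xr agree // !inE eqxx; split.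
Qed.

(** Row [u] moves to column [c], and the exposed row [v] takes the full column that [u] held, where
    its symbol is a singleton. With no transversal, the symbol of [(u, c)] must recur on the new
    diagonal. *)
Lemma exposable_place (C : {set 'I_n}) D c u :
  [disjoint C & F] -> p i \in C -> c \in C -> exposable C D c ->
  u \in U -> u \notin D ->
  used_in C (A u c) \/
  exists r, [/\ r != i, p r \notin C, p r \notin F, A r (p r) = A u c &
                exposable (p r |: C) (u :: D) (p r)].
Proof.
move=> dCF iC cC [s [v [sv nears spare agree sym]]] uU uD.
have notF x : x \in C -> x \notin F by move=> xC; rewrite (disjointFr dCF xC).
pose s' := (tperm v u * s)%g.
have s'u : s' u = c.
  by rewrite swap_permE; case: eqP => [->//|_]; rewrite eqxx.
have s'v : u != v -> s' v \in F.
  move=> uv; rewrite swap_permE eqxx; case: (spare u uU uD) => // e.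
  by rewrite e eqxx in uv.
have s'E x : x != u -> x != v -> s' x = s x.
  by move=> xu xv; rewrite swap_permE (negPf xu) (negPf xv).
have near' : near_transversal A s' u.
  have [uv|uv] := eqVneq u v; first by rewrite /s' uv tperm1 mul1g.
  apply: swap_near => // z zv zu; apply: contraNneq zv => e.
  have /fullF/singleP H : s u \in F.
    by case: (spare u uU uD) => // e'; rewrite e' eqxx in uv.
  by have [-> _] := H v _ _ e.
have [r ru] := near_repeat noT near'; rewrite s'u => er.
have rF : s' r \notin F.
  apply/negP => /(fullF r)/singleP/(_ u c (esym er))[e _].
  by rewrite e eqxx in ru.
have rv : r != v.
  apply: contraNneq rF => rv; rewrite rv; apply: s'v.
  by rewrite eq_sym -rv.
rewrite s'E // in er rF.
have [sC|sC] := boolP (s r \in C).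
  left; case: (sym r rv sC); first by rewrite er.
  by move/singleP/(_ u c (esym er)) => [e _]; rewrite e eqxx in ru.
(* Outside [C] and [F] the diagonal still follows [p]. The cells of [u] and [r] share a symbol, so
   [r] can be exposed in place of [u]. *)
right; exists r; have pr : p r = s r.
  have e : p ((p^-1)%g (s r)) = s r by rewrite permKV.
  have := agree ((p^-1)%g (s r)); rewrite e => /(_ sC rF)/perm_inj e'.
  by rewrite -[in LHS]e' e.
have ri : r != i by apply: contraNneq sC => ri; rewrite -pr ri.
rewrite pr; split=> //; exists s', r; split.
- exact: s'E.
- move=> x y; rewrite !inE => xr yr /=.
  have [xu|xu] := eqVneq x u; have [yu|yu] := eqVneq y u.
  + by rewrite xu yu.
  + rewrite xu s'u -er -(s'E r) // => e; have := near' r y.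
    rewrite !inE => /(_ ru yu e) e'; by rewrite e' eqxx in yr.
  + rewrite yu s'u -er -(s'E r) // => e; have := near' x r.
    rewrite !inE => /(_ xu ru e) e'; by rewrite e' eqxx in xr.
  + by apply: near'.
- move=> w wU; rewrite inE negb_or => /andP[wu wD]; right.
  have [wv|wv] := eqVneq w v; first by rewrite wv s'v // -wv eq_sym.
  by rewrite s'E //; case: (spare w wU wD) => // e; rewrite e eqxx in wv.
- move=> x; rewrite !inE negb_or => /andP[_ xC] xF.
  have xu : x != u.
    apply: contraNneq (xF) => xu; move: uU; rewrite -xu !inE => /orP[/eqP xi|//].
    by rewrite xi iC in xC.
  have xv : x != v.
    by apply: contraNneq (xC) => xv; rewrite -(agree x xC xF) xv sv.
  by rewrite s'E // agree.
move=> x xr; rewrite !inE => /orP[/eqP sx|sxC].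
  have : s' x = s' r by rewrite sx s'E.
  by move/perm_inj => e; rewrite e eqxx in xr.
have [xu|xu] := eqVneq x u.
  left; apply/used_inP; exists r; rewrite pr !inE eqxx; split=> //.
  by rewrite xu s'u.
have xv : x != v.
  by apply: contraTneq sxC => xv; rewrite (disjointFl dCF) // xv s'v // -xv eq_sym.
rewrite s'E // in sxC *; case: (sym x xv sxC) => [H|]; [left | by right].
by apply: used_inS H; apply: subsetUr.
Qed.

Lemma exposable_start c : c \in p @: (i |: I) -> exposable (p @: (i |: I)) [::] c.
Proof.
have inC x : p x \in p @: (i |: I) -> (x == i) || single A x (p i).
  by rewrite mem_imset ?inE //; apply: perm_inj.
case/imsetP=> x; rewrite !inE; have [xi _ -> | xi /= sx ->] := eqVneq x i.
  exists p, i; split=> // [|w|y yi yC]; first by rewrite xi.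
    by rewrite !inE => /orP[/eqP|]; [left | right].
  by left; apply/used_inP; exists y.
exists (tperm i x * p)%g, i; split.
- by rewrite swap_permE eqxx.
- exact: single_swap_near.
- move=> w; rewrite !inE => /orP[/eqP-> _|wF _]; [by left | right].
  rewrite swap_permE; have [wi|wi] := eqVneq w i.
    by rewrite wi (negPf exposed_not_full) in wF.
  have [wx|//] := eqVneq w x.
  have := near_single_swap noT near xi sx.
  by rewrite (fullF i) // -wx.
- move=> y yC _; rewrite swap_permE.
  have [yi|_] := eqVneq y i; first by rewrite yi imset_f ?inE ?eqxx in yC.
  have [yx|//] := eqVneq y x.
  by rewrite yx imset_f // !inE sx orbT in yC.
move=> y yi; rewrite swap_permE (negPf yi); have [->|yx] := eqVneq y x; first by right.
by left; apply/used_inP; exists y.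
Qed.

Lemma start_disjoint : [disjoint p @: (i |: I) & F].
Proof.
apply/pred0P => c /=; apply/negP => /andP[/imsetP[x + ->] xF].
rewrite !inE; have [xi _|xi /= sx] := eqVneq x i.
  by move: xF; rewrite xi (negPf exposed_not_full).
by have := near_single_swap noT near xi sx; rewrite (fullF i).
Qed.

(* Drisko's augmentation: each further spare row enlarges the set of exposable
   columns, since it meets more of them than [p] has symbols there. *)
Lemma exposable_grow (us : seq 'I_n) :
  uniq us -> {subset us <= U} ->
  exists (C : {set 'I_n}) (Rg : {set 'I_n * 'I_n}),
  [/\ [/\ p i \in C, [disjoint C & F] & #|C| = #|I|.+1 + size us],
      forall c, c \in C -> exposable C us c,
      forall c, c \in Rg -> [/\ c.1 \in us, c.2 \notin F & used A p i (A c.1 c.2)] &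
      2 * #|Rg| = size us * (2 * #|I| + (size us).+1)].
Proof.
elim: us => [_ _|u us IH /= /andP[uD uni] sub].
  exists (p @: (i |: I)), set0; split.
  - split; [by rewrite imset_f // !inE eqxx | exact: start_disjoint |].
    by rewrite card_imset ?cardsU1 ?inE ?clone_i ?addn0 //; apply: perm_inj.
  - exact: exposable_start.
  - by move=> c; rewrite inE.
  - by rewrite cards0.
have uU : u \in U by apply: sub; rewrite inE eqxx.
have [|C [Rg [[iC dCF cC] expC RgP cR]]] := IH uni.
  by move=> w wus; apply: sub; rewrite inE wus orbT.
have placed c (cin : c \in C) := exposable_place dCF iC cin (expC c cin) uU uD.
have [c cin nc] : exists2 c, c \in C & ~~ used_in C (A u c).
  apply/exists_inP; rewrite -negb_forall_in; apply/negP => /forall_inP all_used.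
  have gP c : exists x, (c \in C) ==> [&& x != i, p x \in C & A x (p x) == A u c].
    case: (boolP (c \in C)) => [/all_used|_]; last by exists i.
    by case/used_inP=> x [xi xC e]; exists x; rewrite xi xC e eqxx.
  pose g c := xchoose (gP c).
  have gE c : c \in C -> [/\ g c != i, p (g c) \in C & A (g c) (p (g c)) = A u c].
    by move=> cin; have /implyP/(_ cin)/and3P[? ? /eqP] := xchooseP (gP c).
  have inj : {in C &, injective (p \o g)}.
    move=> c d cin din /= /perm_inj e; apply: (latA (i := u)).
    by have [_ _ <-] := gE c cin; have [_ _ <-] := gE d din; rewrite e.
  have : (p \o g) @: C \subset C :\ p i.
    apply/subsetP => _ /imsetP[c cin ->] /=; have [gi gC _] := gE c cin.
    by rewrite !inE gC (inj_eq perm_inj) gi.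
  move/subset_leq_card; rewrite card_in_imset // [leqRHS](_ : _ = #|C|.-1).
    by rewrite cC addSn ltnn.
  by rewrite (cardsD1 (p i) C) iC.
case: (placed c cin) => [H|[r [ri rC rF er expr]]]; first by rewrite H in nc.
(* By [placed], row [u] over the old [C] carries only symbols of [p]. The region gains
   [#|I|.+1 + size us] cells, and doubling sums this progression without division. *)
exists (p r |: C), (Rg :|: setX [set u] C); split.
- split; first by rewrite !inE iC orbT.
    by rewrite -setI_eq0 setIUl setU_eq0 !setI_eq0 disjoints1 rF.
  by rewrite cardsU1 rC cC /= addnS.
- move=> d; rewrite !inE => /orP[/eqP->//|din].
  exact: exposable_weaken (expC d din).
- move=> d; rewrite !inE => /orP[/RgP[d1 d2 d3]|/andP[/eqP d1 d2]].
    by split=> //; rewrite d1 orbT.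
  rewrite d1 eqxx (disjointFr dCF d2); split=> //.
  case: (placed d.2 d2) => [/used_in_used//|[x [xi _ _ e _]]].
  by apply/usedP; exists x.
rewrite cardsU (_ : Rg :&: _ = set0) ?cards0 ?subn0 ?cardsX ?cards1; last first.
  apply/setP => d; rewrite !inE; apply/negP => /andP[/RgP[d1 _ _] /andP[/eqP e _]].
  by rewrite -e d1 in uD.
rewrite cC /=; move: cR; set a := #|Rg|; set b := #|I|; set l := size us; lia.
Qed.

(** All [#|F|.+1] spare rows are inserted. The first bound says that the final [C] is disjoint from
    [F]; the second is twice [region_bound], where [p] has at most [n - #|F|.+1] clone rows because
    its cells in [F] are singletons. *)
Lemma full_columns_bound :
  #|I| + #|F| + 2 <= n - #|F| /\
  4 * nsym A + #|F|.+1 * (2 * #|I| + #|F|.+2) <=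
     2 * (n * n) + 2 * nsingle A + 2 * (n - #|F|.+1).
Proof.
have cU : #|U| = #|F|.+1.
  rewrite /U cardsU1 inE (negPf exposed_not_full) /= add1n; congr _.+1.
  rewrite -(card_imset _ (@perm_inj _ p)); apply: eq_card => y.
  apply/imsetP/idP => [[x + ->]|yG]; first by rewrite inE.
  by exists ((p^-1)%g y); rewrite ?inE permKV.
have [||C [Rg [[_ dCF cC] _ RgP cR]]] := @exposable_grow (enum U).
- exact: enum_uniq.
- by move=> x; rewrite mem_enum.
move: cC cR; rewrite -cardE cU => cC cR.
have leF : #|F| <= #|[set x | single A x (p x)]|.
  have <- : #|p @: [set x | p x \in F]| = #|F|.
    apply: eq_card => y; apply/imsetP/idP => [[x + ->]|yG]; first by rewrite inE.
    by exists ((p^-1)%g y); rewrite ?inE permKV.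
  rewrite card_imset; last exact: perm_inj.
  by rewrite subset_leq_card //; apply/subsetP => x; rewrite !inE => /(fullF x).
have CF : #|C| + #|F| <= n.
  have := subset_leq_card (subsetT (C :|: F)); rewrite cardsU cardsT card_ord.
  by move: dCF; rewrite -setI_eq0 => /eqP->; rewrite cards0 subn0.
split; first by lia.
have := @region_bound n A p i Rg.
have := card_clone_rows clone_i.
set K := #|clone_rows _ _ _| => cK.
have RgU c : c \in Rg -> used A p i (A c.1 c.2) by case/RgP.
have RgN x : x != i -> (x, p x) \notin Rg.
  move=> xi; apply/negP => /RgP[/=]; rewrite mem_enum !inE (negPf xi) /=.
  by move=> xF; rewrite xF.
move/(_ RgU RgN); move: cR leF cK; rewrite /reverse_coercion.
set a := #|Rg|; set f := #|F|; set t := #|I|; set k := #|_|; lia.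
Qed.

End FullColumns.

(** * The contradiction *)

Local Open Scope ring_scope.

Lemma full_columns_contra (R : realFieldType) (q N f t s s1 : R) :
  38 / 100 < q -> q < 4 / 10 -> 0 <= f -> 0 <= t ->
  (1 + q) * N ^+ 2 <= 2 * s -> s1 <= f * N + (N - f) * t ->
  t + f + 2 <= N - f -> 2 * q * N + 1 - q < 2 * (f + 1) ->
  4 * s + (f + 1) * (2 * t + (f + 2)) <= 2 * N ^+ 2 + 2 * s1 + 2 * (N - (f + 1)) ->
  False.
Proof.
move=> q_lo q_hi f0 t0 big s1_le t_le f_lo count.
have N0 : 0 <= N by lra.
have qN : 38 / 100 * N <= q * N by rewrite ler_wpM2r // ltW.
have qNN : 38 / 100 * N ^+ 2 <= q * N ^+ 2 by rewrite ler_wpM2r ?exprn_ge0 // ltW.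
(* After elimination of [s] and [s1], [t] has the nonnegative coefficient [2 * (N - 2 * f - 1)];
   [h1] replaces it by its largest value [N - 2 * f - 2]. *)
have h1 : 0 <= (N - 2 * f - 2 - t) * (2 * N - 4 * f - 2) by apply: mulr_ge0; lra.
(* convexity in [f] on [[38/100 N - 7/10, N/2]] *)
have h2 : 0 <= (f - (38 / 100 * N - 7 / 10)) * (N / 2 - f) by apply: mulr_ge0; lra.
have h3 : 0 <= N * (N / 2 - f) by apply: mulr_ge0; lra.
have h4 : 0 <= N ^+ 2 by apply: exprn_ge0.
nra.
Qed.

(** Here [q] is determined: [(1 - q) ^+ 2 = q], so [k ^+ 2 < q * N ^+ 2], while the count gives the
    reverse. *)
Lemma row_region_contra (R : realFieldType) (q N k s : R) :
  q ^+ 2 = 3 * q - 1 -> q < 1 -> 0 <= k -> 0 < k ->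
  (1 + q) * N ^+ 2 <= 2 * s -> k < (1 - q) * N ->
  2 * s + k <= N ^+ 2 + k ^+ 2 -> False.
Proof.
move=> q2 q1 k0 kp big k_lt count.
have : k ^+ 2 < ((1 - q) * N) ^+ 2 by rewrite ltr_pXn2r // nnegrE; lra.
have -> : ((1 - q) * N) ^+ 2 = q * N ^+ 2.
  by rewrite exprMn; congr (_ * _); rewrite sqrrB q2; ring.
lra.
Qed.

(** Eliminating [s1] leaves a bound that does not decrease in [b], so [b = k - 1] is the worst
    case. *)
Lemma row_region_count (n k b s s1 : nat) :
  (k <= n -> b < k -> s1 <= n * b ->
   2 * s + (n - k) * b + b.+1 <= n * n + s1 + k -> 2 * s + k <= n * n + k * k)%N.
Proof.
case: k => // k kn bk; have : (k * b <= k * k)%N by rewrite leq_mul2l -ltnS bk orbT.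
have : (n * b = k.+1 * b + (n - k.+1) * b)%N by rewrite -mulnDl subnKC.
move: (_ - _)%N => d; rewrite !mulSn mulnS; lia.
Qed.

(** * Singleton degrees in a minimal counterexample *)

Section MinimalCounterexample.
Variables (R : realFieldType) (q : R).
Hypothesis q2 : q ^+ 2 = 3 * q - 1.
Hypothesis q_lo : 38 / 100 < q.
Hypothesis q_hi : q < 4 / 10.

(* For [q = (3 - sqrt 5) / 2] this is the threshold of the theorem. *)
Definition many (n s : nat) : bool := (1 + q) * n%:R ^+ 2 <= 2 * s%:R.

Variables (m : nat) (A : array m.+1).
Local Notation n := m.+1.
Hypothesis latA : row_latin A.
Hypothesis noT : ~ has_transversal A.
Hypothesis maxA : forall B : array n, row_latin B -> (nsym A < nsym B)%N -> has_transversal B.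
Hypothesis manyA : many n (nsym A).
Hypothesis IH : forall B : array m, row_latin B -> many m (nsym B) -> has_transversal B.

Local Notation a i := #|row_singles A i|.
Local Notation t j := #|col_singles A j|.
Local Notation mx i j := #|mixed A i j|.

Lemma order_lower :
  [/\ 38 / 100 < q, q < 4 / 10, 0 <= (n%:R : R) & 38 / 100 * n%:R <= q * n%:R].
Proof. by split; rewrite // ler_wpM2r // ltW. Qed.

(** The deleted array falls below its threshold, and the two thresholds differ by [(1 + q) / 2]
    times [n ^ 2 - (n - 1) ^ 2 = 2 * n - 1]. *)
Lemma single_degrees i j :
  single A i j ->
  (1 + q) * (2 * n%:R - 1) < 2 * ((a i)%:R + (t j)%:R + (mx i j)%:R - 1).
Proof.
move=> sij.
have few : ~~ many m (nsym (delete A i j)).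
  apply/negP => /(IH (delete_latin latA)) h; exact: noT (delete_single sij h).
have := nsym_delete (clone_far latA noT maxA) sij; rewrite -addn1 -(ler_nat R) !natrD.
move: manyA few; rewrite /many -ltNge -[n%:R]natr1; lra.
Qed.

Lemma row_degree_lower i j : single A i j -> 2 * q * n%:R + 1 - q < 2 * (a i)%:R.
Proof.
move=> sij; have := single_degrees sij.
have := card_mixed_col latA noT maxA i j; rewrite -(ler_nat R) natrD; lra.
Qed.

(* The columns [y] of singletons [(i, y)] for which [clone_degrees] forces any
   cell of column [y] to be a singleton in each row of larger degree. *)
Definition heavy i := [set y in row_singles A i | (n <= a i + t y)%N].

Lemma light_mixed i y :
  y \in row_singles A i :\: heavy i -> 2 * q * n%:R + 3 - q < 2 * (mx i y)%:R.
Proof.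
rewrite !inE => /andP[+ siy]; rewrite siy -ltnNge -addn1 -(ler_nat R) !natrD.
by have := single_degrees siy; lra.
Qed.

(** With two light columns, [a i] and their two mixed counts would each exceed about [q * n],
    against [sum_mixed_row], as [3 * q > 1]. *)
Lemma card_light i j : single A i j -> (#|row_singles A i :\: heavy i| <= 1)%N.
Proof.
move=> sij; apply/card_le1_eqP => y z yL zL; apply/eqP/negPn/negP => yz.
have := sum_mixed_row latA noT maxA i.
have yJ := subsetP (subsetDl _ _) _ yL; have zJ := subsetP (subsetDl _ _) _ zL.
rewrite (bigD1 y) //= (bigD1 z) /=; last by rewrite zJ.
set S := \sum_(_ | _) _ => le.
have {le S} : (a i + mx i y + mx i z <= n)%N by apply: leq_trans le; rewrite -addnA !leq_add2l leq_addr.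
rewrite -(ler_nat R) !natrD.
have := light_mixed yL; have := light_mixed zL; have := row_degree_lower sij.
by have [] := order_lower; lra.
Qed.

(** Otherwise [sum_mixed_row] fails: without light columns it gives [3 * a i <= n], and with one
    light [y] it gives [2 * a i + mx i y <= n + 1]. Both contradict [3 * q > 1]. *)
Lemma exists_heavy i j : single A i j ->
  exists2 y, single A i y & (mx i y + #|row_singles A i :\: heavy i| <= 1)%N.
Proof.
move=> sij; have sum := sum_mixed_row latA noT maxA i; have aP := row_degree_lower sij.
have b1 := card_light sij; set L := _ :\: _ in b1 *.
case: (boolP [exists y, single A i y && (mx i y + #|L| <= 1)%N]).
  by case/existsP=> y /andP[]; exists y.
rewrite negb_exists => /forallP H; exfalso.
have {}H y : single A i y -> (2 <= mx i y + #|L|)%N.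
  by move=> siy; move: (H y); rewrite siy -ltnNge.
have [lo hi n0 qn] := order_lower.
have [/eqP L0|Ln0] := eqVneq #|L| 0%N.
  have : (a i + a i * 2 <= n)%N.
    apply: leq_trans sum; rewrite leq_add2l -sum_nat_const leq_sum // => y.
    by rewrite inE => /H; rewrite (eqP L0) addn0.
  rewrite -(ler_nat R) !natrD natrM; lra.
have [y yL] : exists y, y \in L by apply/card_gt0P; rewrite lt0n.
have yJ : y \in row_singles A i by move: yL; rewrite inE => /andP[].
have rest : (a i <= (\sum_(z in row_singles A i | z != y) mx i z).+1)%N.
  rewrite (cardsD1 y) yJ ltnS -sum1_card (eq_bigl (fun z => (z \in row_singles A i) && (z != y))).
    by rewrite leq_sum // => z /andP[+ _]; rewrite inE => /H; lia.
  by move=> z; rewrite !inE andbC.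
have : (a i + mx i y + a i <= n + 1)%N.
  rewrite addn1; apply: leq_trans (leq_add (leqnn _) rest) _; rewrite addnS ltnS.
  by rewrite (bigD1 y) //= addnA in sum.
have := light_mixed yL; rewrite -(ler_nat R) !natrD; lra.
Qed.

Lemma heavy_singles x y0 :
  single A x y0 -> (forall z, single A z y0 -> a x <= a z)%N ->
  {in col_singles A y0 & heavy x, forall z y, single A z y}.
Proof.
move=> sx minx z y; rewrite !inE => /minx az /andP[_ ay].
apply/negPn/negP => /(clone_degrees latA noT maxA).
by rewrite ltnNge (leq_trans ay) // leq_add2r.
Qed.

(** The mixed and light columns lost cost at most 1 together by [exists_heavy], which the [- 1] in
    [single_degrees] absorbs. *)
Lemma heavy_lower x y0 :
  single A x y0 -> (forall y, single A x y -> t y <= t y0)%N ->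
  (1 + q) * (2 * n%:R - 1) <= 2 * (#|heavy x|%:R + (t y0)%:R).
Proof.
move=> sx maxt; have [y sy] := exists_heavy sx; rewrite -(ler_nat R).
have := maxt y sy; rewrite -(ler_nat R).
have : (a x <= #|heavy x| + #|row_singles A x :\: heavy x|)%N.
  have := cardsID (heavy x) (row_singles A x).
  by move=> <-; rewrite leq_add2r subset_leq_card // subsetIr.
rewrite -(ler_nat R) !natrD; have := single_degrees sy; lra.
Qed.

Lemma minimal_counterexample : False.
Proof.
have manyP := manyA; rewrite /many in manyP.
have low : (2 * nsym A)%:R <= (n * n + nsingle A)%:R :> R.
  by rewrite ler_nat nsingle_lower.
rewrite natrM !natrD natrM in low.
pose F := [set y | t y == n].
have fullF x y : y \in F -> single A x y.
  rewrite inE => /eqP ty; suff: x \in col_singles A y by rewrite inE.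
  have /eqP-> : col_singles A y == setT by rewrite eqEcard subsetT cardsT card_ord ty /=.
  by rewrite inE.
have [y1 y1F] : exists y, y \notin F.
  apply/existsP; rewrite -negb_forall; apply/negP => /forallP allF; apply: noT.
  apply: (@perm_transversalW _ _ 1%g) => x y.
  by rewrite !perm1 => /(singleP _ _ _ (fullF _ _ (allF y)))[].
case: (@arg_maxnP _ y1 [pred y | y \notin F] (fun y => t y) y1F) => y0 y0F maxt.
have [i ni] : exists i, ~~ single A i y0.
  apply/existsP; rewrite -negb_forall; apply: contra y0F => /forallP all0.
  rewrite inE -[eqbRHS]card_ord -cardsT; apply/eqP; congr #|pred_of_set _|.
  by apply/setP => x; rewrite !inE all0.
have [p [pi near]] := clone_near latA noT maxA ni.
have clone_i : ~~ single A i (p i) by rewrite pi.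
have le1 : (nsingle A <= #|F| * n + #|~: F| * t y0)%N.
  rewrite nsingle_sum (bigID (fun y => y \in F)) /= leq_add //.
    rewrite -sum_nat_const; apply: leq_sum => y; by rewrite inE => /eqP->.
  apply: (@leq_trans (\sum_(y in ~: F) t y0)); last by rewrite sum_nat_const.
  rewrite (eq_bigl (fun y => y \notin F)); last by move=> y; rewrite inE.
  by apply: leq_sum => y; apply: maxt.
have cF : (#|F| + #|~: F|)%N = n by rewrite cardsC card_ord.
have [F0|[y yF]] := set_0Vmem F.
  have maxt0 y : (t y <= t y0)%N by apply: maxt; rewrite /= F0 inE.
  have [x0 sx0] : exists x, single A x y0.
    have : (0 < t y0)%N.
      rewrite lt0n; apply/eqP => ty0; move: le1; rewrite F0 ty0 cards0 mul0n muln0.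
      rewrite leqn0 => /eqP s0; move: low manyP; rewrite s0.
      have [lo _ _ qn] := order_lower.
      have n1 : 0 < n%:R :> R by rewrite ltr0n.
      have : 0 < n%:R * (38 / 100 * n%:R) :> R by apply: mulr_gt0 => //; lra.
      have : n%:R * (38 / 100 * n%:R) <= n%:R * (q * n%:R) :> R by rewrite ler_wpM2l.
      lra.
    by case/card_gt0P=> x; rewrite inE; exists x.
  have [x sx minx] : exists2 x, single A x y0 & forall z, single A z y0 -> (a x <= a z)%N.
    case: (@arg_minnP _ x0 [pred x | single A x y0] (fun x => a x) sx0) => x sx minx.
    by exists x.
  have hvy := heavy_lower sx (fun y _ => maxt0 y).
  have rect := rectangle_singles p (heavy_singles sx minx).
  have cK := card_clone_rows clone_i.
  have cL := card_col_single_lt latA noT near clone_i.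
  have bound := row_region_bound latA noT near clone_i.
  move: le1 rect cK cL bound; rewrite F0 setC0 cardsT card_ord cards0 mul0n add0n pi /reverse_coercion.
  move: manyP hvy low.
  set k := #|clone_rows _ _ _|; set r := #|[set x | _]|; set h := #|heavy x|.
  set s := nsym A; set s1 := nsingle A; set b := #|_| => manyP hvy low le1 rect cK cL bound.
  (* The rectangle forces [h + b - n] singletons on [p], which has exactly [n - 1 - k]. With
     [heavy_lower] this yields [k < (1 - q) * n]. *)
  have le_k : (h + b + k + 1 <= 2 * n)%N by clear -rect cK; lia.
  have le_s : (2 * s + k <= n * n + k * k)%N.
    by apply: row_region_count le1 bound => //; clear -cK; lia.
  have [lo hi n0 qn] := order_lower.
  apply: (@row_region_contra R q n%:R k%:R s%:R) => //.
  - by lra.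
  - by rewrite ltr0n; apply: leq_trans cL.
  - by move: le_k; rewrite -(ler_nat R) !natrD natrM; lra.
  - by move: le_s; rewrite -(ler_nat R) !natrD !natrM !expr2; lra.
have [lo hi n0 qn] := order_lower.
have [] := @full_columns_bound n A latA noT p i near clone_i F (fun x y => @fullF x y).
rewrite pi; set f := #|F|; set b := #|_| => le2 bound.
have sij : single A i y by exact: fullF.
(* The clone [(i, y0)] gives [a i + t y0 < n]. As [t y0] is largest outside [F], every singleton of
   row [i] outside [F] is in a light column, and there is at most one. *)
have le3 : (a i <= f + 1)%N.
  rewrite -(cardsID F (row_singles A i)) leq_add ?subset_leq_card ?subsetIr //.
  apply: leq_trans (card_light sij); rewrite subset_leq_card //.
  apply/subsetP => z; rewrite !inE => /andP[zF siz]; rewrite siz andbT /= -ltnNge.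
  apply: leq_ltn_trans (clone_degrees latA noT maxA ni).
  by rewrite leq_add2l; apply: maxt; rewrite /= inE.
have {le2}le2 : (b + f + 2 + f <= n)%N by move: le2; rewrite /reverse_coercion; clear; lia.
have {}bound : (4 * nsym A + (f + 1) * (2 * b + (f + 2)) + 2 * (f + 1) <=
    2 * (n * n) + 2 * nsingle A + 2 * n)%N.
  by rewrite !addn1 addn2; move: bound le2; move: (f.+1 * _)%N => x; rewrite /reverse_coercion; clear; lia.
have dI := row_degree_lower sij.
apply: (@full_columns_contra R q n%:R f%:R b%:R (nsym A)%:R (nsingle A)%:R) => //.
- have -> : n%:R - f%:R = #|~: F|%:R :> R by rewrite -[in n%:R]cF natrD addrC addKr.
  by rewrite -!natrM -natrD ler_nat.
- by move: le2; rewrite -(ler_nat R) !natrD; lra.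
- by move: le3; rewrite -(ler_nat R) natrD; lra.
- by move: bound; rewrite -(ler_nat R) !(natrD, natrM); lra.
Qed.

End MinimalCounterexample.

(** * From minimal counterexamples to the bound on [lr] *)

(** Induction on the order handles deletions; an inner induction on the number of missing symbols
    supplies maximality, since more symbols preserve [many]. *)
Lemma many_symbols_transversal (R : realFieldType) (q : R) :
  q ^+ 2 = 3 * q - 1 -> 38 / 100 < q -> q < 4 / 10 ->
  forall n (A : array n), row_latin A -> many q n (nsym A) -> has_transversal A.
Proof.
move=> q2 q_lo q_hi; elim=> [|m IH] A.
  by move=> _ _; apply: (@perm_transversalW _ _ 1%g) => -[].
have [d] := ubnP (m.+1 * m.+1 - nsym A); elim: d A => // d IHd A lt_d latA manyA.
have [//|noT] := classic (has_transversal A).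
case: (minimal_counterexample q2 q_lo q_hi latA noT _ manyA IH) => B latB ltB.
apply: IHd => //; first by have := nsym_le B; lia.
apply: le_trans manyA _; rewrite ler_pM2l ?ltr0n // ler_nat; exact: ltnW.
Qed.

Lemma lrP n : is_lr n (lr n).
Proof. exact: proj2_sig (ClassicalEpsilon.constructive_indefinite_description _ _). Qed.

(* The threshold involves [sqrt 5] only through an integer inequality, so it can
   be moved from [algC] to a real closed field. *)
Lemma many_algC n s :
  (5 - sqrtC 5) / 4 * (n%:R : algC) ^+ 2 <= s%:R ->
  many ((3 - Num.sqrt 5) / 2 : realalg) n s.
Proof.
set w := sqrtC 5 => le_s; have w0 : 0 <= w by rewrite sqrtC_ge0 ler0n.
rewrite /many; set v := Num.sqrt 5; have v0 : 0 <= v by apply: sqrtr_ge0.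
have v2 : v ^+ 2 = 5 by rewrite sqr_sqrtr ?ler0n.
have [le5|lt5] := leqP (5 * n ^ 2)%N (4 * s)%N.
  have : 0 <= v * n%:R ^+ 2 by rewrite mulr_ge0 ?exprn_ge0 ?ler0n.
  by move: le5; rewrite -(ler_nat realalg) !natrM; lra.
have [d def_d] : exists d, (5 * n ^ 2 = 4 * s + d)%N.
  by exists (5 * n ^ 2 - 4 * s)%N; rewrite subnKC // ltnW.
(* The hypothesis says [d <= sqrt 5 * n ^ 2]; squaring makes it an inequality between naturals,
   valid in either field. *)
have le_d : (d ^ 2 <= 5 * (n ^ 2) ^ 2)%N.
  rewrite -(ler_nat algC) natrX natrM.
  have -> : 5%:R * ((n ^ 2) ^ 2)%N%:R = (w * n%:R ^+ 2) ^+ 2 :> algC.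
    by rewrite exprMn sqrtCK !natrX.
  rewrite lerXn2r ?nnegrE ?mulr_ge0 ?exprn_ge0 ?ler0n //.
  have e : 5 * n%:R ^+ 2 = 4 * s%:R + d%:R :> algC by rewrite -natrX -!natrM -natrD def_d.
  have -> : d%:R = 5 * n%:R ^+ 2 - 4 * s%:R :> algC by rewrite e addrC addKr.
  have le4 : (5 - w) * n%:R ^+ 2 <= 4 * s%:R.
    have -> : (5 - w) * n%:R ^+ 2 = 4 * ((5 - w) / 4 * n%:R ^+ 2) by field.
    by rewrite ler_pM2l ?ltr0n.
  by rewrite lerBlDr addrC -lerBlDr -mulrBl.
have : d%:R <= v * n%:R ^+ 2.
  rewrite -(@ler_pXn2r _ 2) ?nnegrE ?mulr_ge0 ?exprn_ge0 ?ler0n //.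
  by rewrite exprMn v2 -!natrX -natrM ler_nat.
have : (5 * n ^ 2)%N%:R = (4 * s + d)%N%:R :> realalg by rewrite def_d.
by rewrite natrD !natrM; lra.
Qed.

Theorem mainTheorem9 :
  (forall (n : nat) (A : array n), row_latin A ->
     (5 - sqrtC 5) / 4 * (n%:R : algC) ^+ 2 <= (nsym A)%:R ->
     has_transversal A)
  /\
  (forall n : nat, (1 < n)%N ->
     (lr n)%:Z <= Num.ceil ((5 - sqrtC 5) / 4 * (n%:R : algC) ^+ 2)).
Proof.
have main (n : nat) (A : array n) : row_latin A ->
     (5 - sqrtC 5) / 4 * (n%:R : algC) ^+ 2 <= (nsym A)%:R -> has_transversal A.
  move=> latA /many_algC; apply: many_symbols_transversal => //.
  - have : (Num.sqrt 5 : realalg) ^+ 2 = 5 by rewrite sqr_sqrtr ?ler0n.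
    by move: (Num.sqrt _) => v; nra.
  - have : (Num.sqrt 5 : realalg) < 224 / 100.
      rewrite -(@ltr_pXn2r _ 2) ?nnegrE ?sqrtr_ge0 //; [rewrite sqr_sqrtr; lra | lra].
    lra.
  - have : 22 / 10 < (Num.sqrt 5 : realalg).
      rewrite -(@ltr_pXn2r _ 2) ?nnegrE ?sqrtr_ge0 //; [rewrite sqr_sqrtr; lra | lra].
    lra.
split=> // n n1; set C := _ / _ * _.
(* A candidate for [lr n] must be at least [n]. This holds as the coefficient is at least [1 / 2]
   and [n >= 2]. *)
have leC : n%:R <= C.
  have w3 : sqrtC 5 <= 3 :> algC.
    have -> : 3 = sqrtC (3 ^+ 2) :> algC by rewrite sqrCK ?ler0n.
    by rewrite ler_sqrtC ?qualifE /= -?natrX ?ler0n // ler_nat.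
  have half : 1 / 2 <= (5 - sqrtC 5) / 4 :> algC.
    have -> : 1 / 2 = (5 - 3) / 4 :> algC by field.
    by rewrite ler_pM2r ?invr_gt0 ?ltr0n // lerD2l lerN2.
  apply: le_trans (_ : 1 / 2 * n%:R ^+ 2 <= _); last by rewrite ler_wpM2r ?exprn_ge0 ?ler0n.
  rewrite [leLHS](_ : _ = 1 / 2 * (2 * n%:R)); last by field.
  by rewrite ler_wpM2l ?divr_ge0 ?ler0n // -natrX -natrM ler_nat -mulnn leq_mul2r n1 orbT.
have realC : C \is Num.real by apply: ger0_real; apply: le_trans leC; rewrite ler0n.
have [k ceilC] : exists k : nat, Num.ceil C = k%:Z.
  have : 0 <= Num.ceil C by rewrite real_ceil_ge0 // (lt_le_trans _ leC) // (lt_le_trans _ (ler0n _ n)) ?ltrN10.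
  by case: (Num.ceil C) => // k _; exists k.
have leCk : C <= k%:R by have := real_ceil_ge realC; rewrite ceilC.
have nk : (n <= k)%N by rewrite -(ler_nat algC) (le_trans leC).
rewrite ceilC lez_nat; have [_ _ _ least] := lrP n; apply: least => //.
  by apply: leq_trans nk; apply: ltnW.
by move=> A latA kA; apply: main latA (le_trans leCk _); rewrite ler_nat.
Qed.
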